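(* Let $G$ be a finite $p$-group ($p$ prime) with $|G'|=p$ and write $|G:Z(G)|=p^{2n}$. Then for every $r\ge 1$, $$P_r(G)=P_r^{(p)}(n),$$ so $P_r(G)$ depends only on $p$ and $n$ (and not on $|Z(G)|$). Moreover, for every $n\ge 1$ and $r\ge 2$ one has the recursion $$I_r(n)=I_{r-1}(n)+(p^{2n}-1)\,p^{r-1}\,I_{r-1}(n-1),$$ equivalently $$P_r^{(p)}(n)=p^{-2n}P_{r-1}^{(p)}(n)+p^{1-r}\bigl(1-p^{-2n}\bigr)P_{r-1}^{(p)}(n-1),$$ with initial conditions $P_r^{(p)}(0)=1$ (for all $r\ge1$) and $P_1^{(p)}(n)=1$ (for all $n\ge 0$).
   Context: For a finite group $G$ and $r\ge 1$, $P_r(G):=|\{(x_1,\dots,x_r)\in G^r : x_ix_j=x_jx_i\ \text{for all } i,j\}|/|G|^r$. $G'$ is the commutator subgroup and $Z(G)$ the center. For a finite $p$-group with $|G'|=p$, the index $|G:Z(G)|$ is always of the form $p^{2n}$ with $n\ge1$ (the commutator induces a nondegenerate alternating form on $G/Z(G)$). For a prime $p$ and $n\ge 0$, let $V_n=\mathbb F_p^{2n}$ be equipped with any nondegenerate alternating bilinear form $\langle\cdot,\cdot\rangle$ (unique up to change of basis). For $r\ge 1$ define $$I_r(n):=\big|\{(v_1,\dots,v_r)\in V_n^r:\ \langle v_i,v_j\rangle=0\ \forall i<j\}\big|,\qquad P_r^{(p)}(n):=\frac{I_r(n)}{p^{2nr}}.$$ *)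

(* Defs.v *)
From HB Require Import structures.
From mathcomp Require Import all_boot all_order all_algebra all_fingroup.
From mathcomp Require Import all_solvable.

Set Implicit Arguments.
Unset Strict Implicit.
Unset Printing Implicit Defensive.

Import GRing.Theory.
Local Open Scope ring_scope.

Definition commuting_tuples (gT : finGroupType) (G : {group gT}) (r : nat) :
    {set {ffun 'I_r -> gT}} :=
  [set x : {ffun 'I_r -> gT} | [forall i, x i \in G]
     && [forall i, forall j, (x i * x j == x j * x i)%g]].

Definition commuting_prob (gT : finGroupType) (G : {group gT}) (r : nat) : rat :=
  #|commuting_tuples G r|%:R / #|G|%:R ^+ r.

(* [B u u = 0], and not merely antisymmetry, which is weaker when p = 2. *)
Definition alternating_form (F : fieldType) (d : nat) (B : {biscalar 'rV[F]_d}) :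
    Prop :=
  forall u, B u u = 0.

Definition nondegenerate_form (F : fieldType) (d : nat) (B : {biscalar 'rV[F]_d}) :
    Prop :=
  forall u, (forall v, B u v = 0) -> u = 0.

(* For composite p, 'F_p is the prime field of the smallest prime divisor of p;
   the notions below are only meant for p prime. *)
Definition isotropic_count (p n : nat) (B : {biscalar 'rV['F_p]_(2 * n)})
    (r : nat) : nat :=
  #|[set v : {ffun 'I_r -> 'rV['F_p]_(2 * n)} |
      [forall i : 'I_r, forall j : 'I_r, (i < j)%N ==> (B (v i) (v j) == 0)]]|.

Definition isotropic_prob (p n : nat) (B : {biscalar 'rV['F_p]_(2 * n)})
    (r : nat) : rat :=
  (isotropic_count B r)%:R / p%:R ^+ (2 * n * r).

(* Nondegenerate alternating forms exist in every even dimension, so that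
   quantifying over a family of them is not vacuous. *)
Section StandardForm.
Variables (F : fieldType) (n : nat).

Lemma std_lo_subproof (k : 'I_n) : (k < 2 * n)%N.
Proof. by rewrite mul2n -addnn ltn_addr. Qed.
Lemma std_hi_subproof (k : 'I_n) : (n + k < 2 * n)%N.
Proof. by rewrite mul2n -addnn ltn_add2l. Qed.

Definition std_lo (k : 'I_n) := Ordinal (std_lo_subproof k).
Definition std_hi (k : 'I_n) := Ordinal (std_hi_subproof k).

Definition std_form (u v : 'rV[F]_(2 * n)) : F :=
  \sum_(k < n) (u 0 (std_lo k) * v 0 (std_hi k)
                - u 0 (std_hi k) * v 0 (std_lo k)).

Lemma std_form_bilinear : bilinear_for *%R *%R std_form.
Proof.
split=> [w a u v | w a u v]; rewrite /= /std_form mulr_sumr -big_split /=;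
  apply: eq_bigr => k _; rewrite !mxE mulrBr addrACA -opprD.
  by rewrite !mulrDl !mulrA.
by rewrite !mulrDr !(mulrCA (w _ _) a).
Qed.

HB.instance Definition _ :=
  bilinear_isBilinear.Build F 'rV[F]_(2 * n) 'rV[F]_(2 * n) F *%R *%R
    std_form std_form_bilinear.

Lemma std_form_alternating : alternating_form (std_form : {biscalar 'rV[F]__}).
Proof. by move=> u; apply: big1 => k _; rewrite mulrC subrr. Qed.

Lemma std_form_nondegenerate :
  nondegenerate_form (std_form : {biscalar 'rV[F]__}).
Proof.
have lohi k l : std_lo k == std_hi l = false.
  by apply/negbTE; rewrite -val_eqE /= neq_ltn ltn_addr.
have lo_inj k l : (std_lo k == std_lo l) = (k == l) by [].
have hi_inj k l : (std_hi k == std_hi l) = (k == l).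
  by rewrite -val_eqE /= eqn_add2l.
move=> u u0; apply/rowP=> i; rewrite mxE.
have [ltin | leni] := ltnP i n.
  have /= := u0 (delta_mx 0 (std_hi (Ordinal ltin))).
  rewrite /std_form (bigD1 (Ordinal ltin)) //= big1 => [|k /negbTE kN].
    rewrite !mxE !eqxx lohi mulr1 mulr0 subr0 addr0 => <-.
    by congr (u _ _); apply: val_inj.
  by rewrite !mxE !eqxx hi_inj kN lohi !mulr0 subr0.
have ltk : (i - n < n)%N by rewrite ltn_subLR // addnn -mul2n.
have /= := u0 (delta_mx 0 (std_lo (Ordinal ltk))).
rewrite /std_form (bigD1 (Ordinal ltk)) //= big1 => [|k /negbTE kN].
  rewrite !mxE !eqxx [std_hi _ == _]eq_sym lohi mulr1 mulr0 sub0r addr0.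
  move/eqP; rewrite oppr_eq0 => /eqP <-.
  by congr (u _ _); apply: val_inj; rewrite /= subnKC.
by rewrite !mxE !eqxx lo_inj kN [std_hi _ == _]eq_sym lohi !mulr0 subr0.
Qed.

Lemma nondegenerate_alternating_exists :
  exists B : {biscalar 'rV[F]_(2 * n)},
    alternating_form B /\ nondegenerate_form B.
Proof.
by exists std_form; split;
  [exact: std_form_alternating | exact: std_form_nondegenerate].
Qed.

End StandardForm.

(* Main.v *)
Require Import Defs.
From mathcomp Require Import all_boot all_order all_algebra all_fingroup.
From mathcomp Require Import all_solvable.
From mathcomp Require Import zify ring.

Set Implicit Arguments.
Unset Strict Implicit.
Unset Printing Implicit Defensive.

Import GRing.Theory Num.Theory.
Local Open Scope group_scope.

(** Both counts, of commuting tuples in [G] and of isotropic tuples in a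
    symplectic space, are instances of one: given a bimultiplicative map [f] on
    a finite group [G], with [f x x = 1] and values in a group of prime order
    [p], count the tuples of [G] whose entries are pairwise orthogonal for [f].
    For the space, [f] is the form on the additive group; for the group, [f] is
    the commutator, which is bimultiplicative with values in [G'] because a
    normal subgroup of order [p] in a [p]-group is central.

    The count is found by splitting on the first entry [x]. If [x] lies in the
    radical [R] of [f], the other entries are an arbitrary isotropic tuple of
    [G]. If not, they are an isotropic tuple of the orthogonal [H] of [x], the
    kernel of the nontrivial morphism [f x], so [H] has index [p] in [G].
    The radical of [H] grows by the factor [p] ([card_radical_orthogonal]): for
    any [z] of [G] not orthogonal to [x], pairing with [z] maps it onto the
    group of values, and the kernel of this map is [R], since [H] is maximal
    and hence [H] and [z] generate [G]. So [|G| = |R| p^(2n)] is inherited by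
    [H] with [n - 1] in place of [n], and induction on the length gives
    [|R|^r * isotropic_number p r n] tuples of length [r], where
    [isotropic_number] is defined by the recursion of the theorem
    ([card_isotropic_tuples]).

    Staying with subgroups and degenerate pairings, rather than passing to the
    quotient of [H] by its radical, avoids identifying that quotient with the
    symplectic space of dimension [2n - 2]. The radical is trivial for a
    nondegenerate form and is the center for the commutator; in the latter case
    the factor [|R|^r] cancels in the probability. *)

(** * Alternating pairings with values in a group of prime order *)

Record alternating_pairing (gT rT : finGroupType) (G : {set gT})
    (A : {set rT}) (f : gT -> gT -> rT) : Prop := AlternatingPairing {
  pairing_in : {in G &, forall x y, f x y \in A};
  pairingMl : {in G & &, forall x y z, f (x * y) z = f x z * f y z};
  pairingMr : {in G & &, forall x y z, f x (y * z) = f x y * f x z};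
  pairing_alt : {in G, forall x, f x x = 1} }.

Definition orthogonal_set (gT rT : finGroupType) (f : gT -> gT -> rT)
  (G : {set gT}) (x : gT) : {set gT} := [set y in G | f x y == 1].

Definition radical (gT rT : finGroupType) (f : gT -> gT -> rT)
  (G : {set gT}) : {set gT} := [set x in G | [forall y in G, f x y == 1]].

Definition isotropic_tuples (gT rT : finGroupType) (f : gT -> gT -> rT)
    (G : {set gT}) (r : nat) : {set {ffun 'I_r -> gT}} :=
  [set x : {ffun 'I_r -> gT} | [forall i, x i \in G]
     && [forall i, forall j, f (x i) (x j) == 1]].

(** The number of isotropic [r]-tuples when the radical has order 1 and index
    [p ^ (2 * n)]. The value [n.-1 = 0] for [n = 0] is harmless, as its
    coefficient vanishes. *)
Fixpoint isotropic_number (p r n : nat) : nat :=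
  if r is r'.+1 then
    (isotropic_number p r' n
     + (p ^ (2 * n) - 1) * p ^ r' * isotropic_number p r' n.-1)%N
  else 1%N.

(** The image is a nontrivial subgroup of a group of prime order, hence all of
    it. This gives both the index of an orthogonal and, below, the growth of
    the radical. *)
Lemma card_prime_codomain (aT rT : finGroupType) (D : {group aT})
    (A : {group rT}) (g : {morphism D >-> rT}) (x : aT) :
  prime #|A| -> g @* D \subset A -> x \in D -> g x != 1 ->
  #|D| = (#|A| * #|'ker g|)%N.
Proof.
move=> pA sgA xD gx1.
have imA : g @* D = A.
  apply/eqP; rewrite eqEsubset sgA /=.
  apply: (prime_meetG pA); apply/trivgPn; exists (g x) => //.
  by rewrite inE (subsetP sgA) mem_morphim.
rewrite -(LagrangeI D ('ker g)) (setIidPr (subsetIl _ _)) mulnC; congr (_ * _)%N.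
by rewrite -[RHS](congr1 (fun B : {set rT} => #|B|) imA) card_morphim setIid.
Qed.

Section Pairing.

Variables (gT rT : finGroupType) (A : {group rT}) (f : gT -> gT -> rT).

Lemma alternating_pairingS (G H : {group gT}) :
  H \subset G -> alternating_pairing G A f -> alternating_pairing H A f.
Proof.
move=> /subsetP sHG [fA fMl fMr fxx].
by split=> [x y /sHG ? /sHG ?|x y z /sHG ? /sHG ? /sHG ?
  |x y z /sHG ? /sHG ? /sHG ?|x /sHG ?]; auto.
Qed.

Section FixedGroup.

Variable G : {group gT}.
Hypothesis pf : alternating_pairing G A f.

(** Antisymmetry comes from expanding [f (x * y) (x * y) = 1]. *)
Lemma pairing_anti : {in G &, forall x y, f x y * f y x = 1}.
Proof.
move=> x y xG yG; have := pairing_alt pf (groupM xG yG).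
rewrite (pairingMl pf) ?groupM // !(pairingMr pf) //.
by rewrite !(pairing_alt pf) // mul1g mulg1.
Qed.

Lemma pairing_sym : {in G &, forall x y, (f x y == 1) = (f y x == 1)}.
Proof.
move=> x y xG yG; have fxy := pairing_anti xG yG.
by apply/eqP/eqP => e; move: fxy; rewrite e ?mulg1 ?mul1g.
Qed.

Lemma orthogonal_group_set x : x \in G -> group_set (orthogonal_set f G x).
Proof.
move=> xG; pose g := Morphism (fun y z => @pairingMr _ _ _ _ _ pf x y z xG).
by rewrite (_ : orthogonal_set f G x = 'ker g) ?groupP //;
  apply/setP=> y; rewrite !inE.
Qed.

Lemma radical_group_set : group_set (radical f G).
Proof.
apply/group_setP; split=> [|x y].
  rewrite inE group1; apply/forall_inP=> y yG.
  by rewrite pairing_sym // -(can_eq (mulKg (f y 1))) -(pairingMr pf) // !mulg1.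
rewrite !inE => /andP[xG /forall_inP x0] /andP[yG /forall_inP y0].
rewrite groupM //; apply/forall_inP=> z zG.
by rewrite (pairingMl pf) // (eqP (x0 z zG)) (eqP (y0 z zG)) mulg1.
Qed.

End FixedGroup.

Hypothesis pA : prime #|A|.

Lemma card_orthogonal (G : {group gT}) x :
  alternating_pairing G A f -> x \in G :\: radical f G ->
  #|G| = (#|A| * #|orthogonal_set f G x|)%N.
Proof.
move=> pf; rewrite inE => /andP[xR xG].
pose g := Morphism (fun y z => @pairingMr _ _ _ _ _ pf x y z xG).
move: xR; rewrite inE xG /= => /forall_inPn[y yG fxy].
rewrite (card_prime_codomain (g := g) pA _ yG fxy).
  by congr (_ * #|pred_of_set _|)%N; apply/setP=> z; rewrite !inE.
by apply/subsetP=> _ /morphimP[z _ zG ->]; apply: (pairing_in pf).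
Qed.

(** Pairing with an element [z] not orthogonal to [x] is a morphism on the
    radical of the orthogonal [H] of [x], nontrivial at [x] itself. Its kernel
    is the radical of [G]: an element orthogonal to [z] and to the maximal
    subgroup [H] is orthogonal to all of [G]. *)
Lemma card_radical_orthogonal (G : {group gT}) x :
  alternating_pairing G A f -> x \in G :\: radical f G ->
  #|radical f (orthogonal_set f G x)| = (#|A| * #|radical f G|)%N.
Proof.
move=> pf xGR; have cardG := card_orthogonal pf xGR.
move: xGR; rewrite inE => /andP[xR xG].
move: xR; rewrite inE xG /= => /forall_inPn[z zG fxz].
pose H := Group (orthogonal_group_set pf xG).
have defH y : (y \in H) = (y \in G) && (f x y == 1) by rewrite inE.
have sHG : H \subset G by apply/subsetP=> y; rewrite defH => /andP[].
have pfH := alternating_pairingS sHG pf.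
have maxH (K : {group gT}) : H \subset K -> K \subset G -> K :=: H \/ K :=: G.
  suff /maximal_eqP[_] : maximal_eq H G by apply.
  rewrite /maximal_eq p_index_maximal ?orbT //.
  suff -> : #|G : H| = #|A| by [].
  apply/eqP; rewrite -(eqn_pmul2l (cardG_gt0 H)) Lagrange //.
  by rewrite cardG mulnC.
pose R := Group (radical_group_set pfH).
have inR y : (y \in R) = (y \in H) && [forall u in H, f y u == 1] by rewrite inE.
have RG y : y \in R -> y \in G by rewrite inR => /andP[/(subsetP sHG)].
have gM : {in R &, {morph f^~ z : u v / u * v}}.
  by move=> u v /RG uG /RG vG; apply: (pairingMl pf).
pose g := Morphism gM.
have xR : x \in R.
  rewrite inR defH xG (pairing_alt pf xG) eqxx.
  by apply/forall_inP=> u; rewrite defH => /andP[].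
rewrite -[LHS]/#|R| (card_prime_codomain (g := g) pA _ xR fxz); last first.
  by apply/subsetP=> _ /morphimP[y _ /RG yG ->]; apply: (pairing_in pf).
congr (_ * _)%N; apply: eq_card => y; apply/idP/idP.
  case/morphpreP=> yR /set1P /= fyz; have yG := RG y yR.
  move: yR; rewrite inR => /andP[yH /forall_inP y0].
  pose K := Group (orthogonal_group_set pf yG).
  have sHK : H \subset K.
    by apply/subsetP=> u uH; rewrite inE (subsetP sHG) // y0.
  have sKG : K \subset G by apply/subsetP=> u; rewrite inE => /andP[].
  have zK : z \in K by rewrite inE zG fyz eqxx.
  have [eKH | eKG] := maxH K sHK sKG.
    by move: zK; rewrite eKH defH (negbTE fxz) andbF.
  rewrite inE yG; apply/forall_inP=> u; rewrite -eKG inE.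
  by case/andP.
rewrite inE => /andP[yG /forall_inP y0].
apply/morphpreP; split; last by apply/set1P/eqP/y0.
rewrite inR defH yG (pairing_sym pf) // y0 //.
by apply/forall_inP=> u /(subsetP sHG); apply: y0.
Qed.

(** The tuples with first entry [x] are the [x]-extensions of the tuples with
    entries in the orthogonal of [x]. *)
Lemma card_isotropic_tuplesS (G : {group gT}) r :
  alternating_pairing G A f ->
  #|isotropic_tuples f G r.+1|
    = (\sum_(x in G) #|isotropic_tuples f (orthogonal_set f G x) r|)%N.
Proof.
move=> pf.
pose cons x (t : {ffun 'I_r -> gT}) : {ffun 'I_r.+1 -> gT} :=
  [ffun i => oapp t x (unlift ord0 i)].
have cons0 x t : cons x t ord0 = x by rewrite ffunE unlift_none.
have consS x t i : cons x t (lift ord0 i) = t i by rewrite ffunE liftK.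
rewrite -sum1_card (partition_big (fun t : {ffun _} => t ord0) (mem G)) /=; last first.
  by move=> t; rewrite inE => /andP[/forallP tG _]; apply: tG.
apply: eq_bigr => x xG; rewrite sum1_card.
have cons_inj : injective (cons x).
  by move=> t u /ffunP e; apply/ffunP=> i; have := e (lift ord0 i); rewrite !consS.
rewrite -(card_imset _ cons_inj); apply: eq_card => t; apply/idP/imsetP.
  rewrite -topredE /= inE => /andP[/andP[/forallP tG /forallP t0] /eqP tx].
  have {}t0 i j : f (t i) (t j) == 1 by have /forallP := t0 i; apply.
  exists [ffun i => t (lift ord0 i)].
    rewrite inE; apply/andP; split; apply/forallP=> i.
      by rewrite inE ffunE tG -tx t0.
    by apply/forallP=> j; rewrite !ffunE.
  apply/ffunP=> i; case: (unliftP ord0 i) => [j|] ->; rewrite ?consS ?cons0 //.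
  by rewrite ffunE.
case=> u; rewrite inE => /andP[/forallP uG /forallP u0] ->.
have {}u0 i j : f (u i) (u j) == 1 by have /forallP := u0 i; apply.
have {uG} uG i : (u i \in G) /\ f x (u i) == 1.
  by have := uG i; rewrite inE => /andP[].
rewrite -topredE /= inE cons0 eqxx andbT; apply/andP; split; apply/forallP=> i.
  by case: (unliftP ord0 i) => [j|] ->; rewrite ?consS ?cons0 //; case: (uG j).
apply/forallP=> j.
case: (unliftP ord0 i) => [k|] ->; case: (unliftP ord0 j) => [l|] ->;
  rewrite ?consS ?cons0 ?(pairing_alt pf) //.
- by rewrite (pairing_sym pf) //; case: (uG k).
- by case: (uG l).
Qed.

(** The order hypothesis passes to the orthogonal [H] of an element outside
    the radical: [|H| = |G| / p] and its radical is [p] times larger, so its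
    index drops by [p ^ 2]. The factor [p ^ r] of the recursion is the
    [r]-th power of this growth of the radical. *)
Lemma card_isotropic_tuples (G : {group gT}) n r :
  alternating_pairing G A f -> #|G| = (#|radical f G| * #|A| ^ (2 * n))%N ->
  #|isotropic_tuples f G r|
    = (#|radical f G| ^ r * isotropic_number #|A| r n)%N.
Proof.
elim: r => [|r IHr] in G n * => pf cardG.
  rewrite /= mul1n -[RHS](_ : #|[set: {ffun 'I_0 -> gT}]| = 1%N); last first.
    by rewrite cardsT card_ffun card_ord expn0.
  apply: eq_card => t; rewrite !inE.
  by apply/andP; split; apply/forallP=> -[].
have p_gt0 := prime_gt0 pA; set p := #|A| in p_gt0 cardG *.
have sRG : radical f G \subset G by apply/subsetP=> x; rewrite inE => /andP[].
rewrite card_isotropic_tuplesS // (big_setID (radical f G)) /= (setIidPr sRG).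
rewrite (eq_bigr (fun _ => #|isotropic_tuples f G r|)); last first.
  move=> x; rewrite inE => /andP[xG /forall_inP x0]; congr #|pred_of_set _|.
  suff -> : orthogonal_set f G x = G by [].
  apply/setP=> y; rewrite inE andb_idr // => /x0.
  by [].
rewrite [X in (_ + X)%N](eq_bigr
  (fun _ => (p * #|radical f G|) ^ r * isotropic_number p r n.-1)%N); last first.
  move=> x xGR; have cardH := card_orthogonal pf xGR.
  have cardRH := card_radical_orthogonal pf xGR.
  move: (xGR); rewrite inE => /andP[xR xG].
  (* For n = 0 the radical is the whole group, so there is no such x. *)
  case: n cardG => [|n] cardG.
    have /eqP eRG : radical f G == G.
      by rewrite eqEcard sRG cardG muln0 expn0 muln1 leqnn.
    by rewrite eRG xG in xR.
  rewrite -cardRH.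
  pose H := Group (orthogonal_group_set pf xG).
  apply: (IHr H) => /=.
    apply: (@alternating_pairingS G H _ pf).
    by apply/subsetP=> y; rewrite inE => /andP[].
  apply/eqP; rewrite -(eqn_pmul2l p_gt0) -cardH cardRH cardG mulnS !expnS.
  by apply/eqP; rewrite -/p; lia.
rewrite !sum_nat_const (IHr G n pf cardG) cardsD (setIidPr sRG) cardG -/p.
have -> z : (z * p ^ (2 * n) - z = z * (p ^ (2 * n) - 1))%N.
  by rewrite mulnBr muln1.
rewrite /= expnS expnMn.
ring.
Qed.

End Pairing.

Lemma isotropic_numberS p r n :
  isotropic_number p r.+1 n
    = (isotropic_number p r n
       + (p ^ (2 * n) - 1) * p ^ r * isotropic_number p r n.-1)%N.
Proof. by []. Qed.

Lemma isotropic_number1 p n : (0 < p)%N -> (isotropic_number p 1 n = p ^ (2 * n))%N.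
Proof. by move=> p0; rewrite /= expn0 !muln1 subnKC // expn_gt0 p0. Qed.

Lemma isotropic_number0 p r : isotropic_number p r 0 = 1%N.
Proof. by elim: r => //= r ->; rewrite muln0 expn0 subnn mul0n. Qed.

Local Open Scope ring_scope.

(** * The two instances: bilinear forms and commutators *)

(** The form is a pairing on the additive group; nondegeneracy says that its
    radical is trivial. *)
Lemma isotropic_count_number p n (B : {biscalar 'rV['F_p]_(2 * n)}) r :
  prime p -> alternating_form B -> nondegenerate_form B ->
  isotropic_count B r = isotropic_number p r n.
Proof.
move=> p_pr altB ndB.
have pf : alternating_pairing [set: 'rV['F_p]_(2 * n)] [set: 'F_p] B.
  split=> [x y _ _|x y z _ _ _|x y z _ _ _|x _].
  - exact: in_setT.
  - exact: linearDl.
  - exact: linearDr.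
  - exact: altB.
have rad1 : radical B [set: 'rV['F_p]_(2 * n)] = [set 0].
  apply/setP=> u; rewrite !inE /=; apply/forall_inP/eqP => [u0|-> v _].
    by apply: ndB => v; apply/eqP/u0; rewrite inE.
  by rewrite linear0l.
have cardA : #|[set: 'F_p]| = p by rewrite cardsT card_Fp.
have := @card_isotropic_tuples _ _ [group of [set: 'F_p]] B _
  [group of [set: 'rV['F_p]_(2 * n)]] n r pf.
rewrite /= rad1 cards1 cardA exp1n !mul1n cardsT card_mx card_Fp // mul1n.
move=> /(_ p_pr erefl) <-; apply: eq_card => v; rewrite !inE.
have BN x y : B y x = - B x y.
  apply/eqP; rewrite -addr_eq0; apply/eqP; rewrite addrC.
  exact: (pairing_anti pf (in_setT x) (in_setT y)).
apply/forallP/andP => [v0 | [_ /forallP v0] i].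
  split; apply/forallP=> i; first by rewrite inE.
  apply/forallP=> j; have /forallP/(_ i) := v0 j; have /forallP/(_ j) := v0 i.
  case: ltngtP => [_ /= -> //|_ _ /=|/val_inj -> _ _]; last by rewrite altB.
  by rewrite BN oppr_eq0.
by apply/forallP=> j; apply/implyP=> _; have /forallP/(_ j) := v0 i.
Qed.

(** The conjugations in the expansions of [[~ x * y, z]] and [[~ x, y * z]]
    act trivially on central commutators. *)
Lemma commutator_pairing (gT : finGroupType) (G : {group gT}) :
  (G^`(1) \subset 'Z(G))%g -> alternating_pairing G G^`(1)%g commg.
Proof.
move=> /subsetP sZ.
have cZ x y z : x \in G -> y \in G -> z \in G -> ([~ x, y] ^ z = [~ x, y])%g.
  move=> xG yG zG; have /centerP[_ cG] := sZ _ (mem_commg xG yG).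
  by rewrite conjgE cG // mulKg.
split=> [x y xG yG|x y z xG yG zG|x y z xG yG zG|x _].
- exact: mem_commg.
- by rewrite commMgJ cZ.
- rewrite commgMJ cZ //.
  by have /centerP[_ ->] := sZ _ (mem_commg xG zG); rewrite ?groupR.
- exact: commgg.
Qed.

Lemma radical_commg (gT : finGroupType) (G : {group gT}) :
  radical commg G = 'Z(G)%g.
Proof.
apply/setP=> x; rewrite inE; apply/andP/centerP => -[xG xC]; split=> //.
  by move=> y yG; apply/commgP; apply: (forall_inP xC).
by apply/forall_inP=> y yG; apply/commgP/xC.
Qed.

Lemma isotropic_tuples_commg (gT : finGroupType) (G : {group gT}) r :
  isotropic_tuples commg G r = commuting_tuples G r.
Proof.
apply/setP=> x; rewrite !inE; congr (_ && _).
apply: eq_forallb => i; apply: eq_forallb => j.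
by apply/commgP/eqP.
Qed.

(** A nontrivial normal subgroup of a nilpotent group meets the center, and a
    subgroup of prime order is contained in what it meets nontrivially. *)
Lemma prime_normal_sub_center (gT : finGroupType) (G N : {group gT}) :
  nilpotent G -> (N <| G)%g -> prime #|N| -> N \subset 'Z(G)%g.
Proof.
move=> nilG nNG pN; apply: (prime_meetG pN); apply: meet_center_nil => //.
by rewrite -cardG_gt1 prime_gt1.
Qed.

(** As [|G| ^ r = |'Z(G)| ^ r * p ^ (2 * n * r)], the center cancels. *)
Lemma commuting_prob_isotropic p (gT : finGroupType) (G : {group gT}) n r :
  prime p -> (p.-group G)%g -> #|(G^`(1))%g| = p ->
  #|G : ('Z(G))%g|%g = (p ^ (2 * n))%N ->
  commuting_prob G r = (isotropic_number p r n)%:R / p%:R ^+ (2 * n * r).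
Proof.
move=> p_pr pG cG' iZ.
have sG'Z : (G^`(1) \subset 'Z(G))%g.
  apply: prime_normal_sub_center; rewrite ?cG' ?der_normal //.
  exact: pgroup_nil pG.
have cardG : #|G| = (#|'Z(G)%g| * p ^ (2 * n))%N.
  by rewrite -iZ Lagrange ?center_sub.
have := @card_isotropic_tuples _ _ [group of G^`(1)%g] commg _ G n r.
rewrite /= cG' radical_commg isotropic_tuples_commg => /(_ p_pr).
move=> /(_ (commutator_pairing sG'Z) cardG) cardJ.
rewrite /commuting_prob cardJ cardG !natrM !natrX exprMn -exprM.
by rewrite -mulf_div divff ?mul1r // expf_neq0 // pnatr_eq0 -lt0n cardG_gt0.
Qed.

(** * The recursion *)

Theorem theorem7p3 (p : nat) (p_prime : prime p)
    (B : forall n : nat, {biscalar 'rV['F_p]_(2 * n)})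
    (B_alt : forall n : nat, alternating_form (B n))
    (B_nondeg : forall n : nat, nondegenerate_form (B n)) :
  [/\ (forall (gT : finGroupType) (G : {group gT}) (n : nat),
         (p.-group G)%g -> #|(G^`(1))%g| = p -> #|G : ('Z(G))%g|%g = (p ^ (2 * n))%N ->
         forall r : nat, (1 <= r)%N -> commuting_prob G r = isotropic_prob (B n) r),
      (forall (gT hT : finGroupType) (G : {group gT}) (H : {group hT}) (n : nat),
         (p.-group G)%g -> #|(G^`(1))%g| = p -> #|G : ('Z(G))%g|%g = (p ^ (2 * n))%N ->
         (p.-group H)%g -> #|(H^`(1))%g| = p -> #|H : ('Z(H))%g|%g = (p ^ (2 * n))%N ->
         forall r : nat, (1 <= r)%N -> commuting_prob G r = commuting_prob H r),
      (forall n r : nat, (1 <= n)%N -> (2 <= r)%N ->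
         isotropic_count (B n) r
         = (isotropic_count (B n) r.-1
            + (p ^ (2 * n) - 1) * p ^ r.-1 * isotropic_count (B n.-1) r.-1)%N),
      (forall n r : nat, (1 <= n)%N -> (2 <= r)%N ->
         isotropic_prob (B n) r
         = p%:R ^ (- (2 * n)%:Z) * isotropic_prob (B n) r.-1
           + p%:R ^ (1 - r%:Z) * (1 - p%:R ^ (- (2 * n)%:Z))
             * isotropic_prob (B n.-1) r.-1)
    & (forall r : nat, (1 <= r)%N -> isotropic_prob (B 0%N) r = 1)
      /\ (forall n : nat, isotropic_prob (B n) 1 = 1)].
Proof.
have p0 : p%:R != 0 :> rat by rewrite pnatr_eq0 -lt0n prime_gt0.
have countE n r : isotropic_count (B n) r = isotropic_number p r n.
  exact: isotropic_count_number.
have probE n r :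
    isotropic_prob (B n) r = (isotropic_number p r n)%:R / p%:R ^+ (2 * n * r).
  by rewrite /isotropic_prob countE.
split=> [gT G n pG cG iG r _|gT hT G H n pG cG iG pH cH iH r _|n r _|n r|].
- by rewrite probE (commuting_prob_isotropic _ p_prime pG cG iG).
- rewrite (commuting_prob_isotropic _ p_prime pG cG iG).
  by rewrite (commuting_prob_isotropic _ p_prime pH cH iH).
- by case: r => // r _; rewrite !countE.
- case: n r => // n [|[|r]] // _ _; rewrite !probE isotropic_numberS [_.+2.-1]/= [_.+1.-1]/=.
  have -> : (1 - r.+2%:Z) = - (r.+1)%:Z by lia.
  have expS : (2 * n.+1 = 2 * n + 2)%N by lia.
  have expM : (2 * n.+1 * r.+1 = 2 * n * r.+1 + (r.+1 + r.+1))%N by lia.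
  have expT : (2 * n.+1 * r.+2 = 2 * n * r.+1 + (r.+1 + r.+1) + (2 * n + 2))%N.
    by lia.
  rewrite -!exprnN natrD !natrM natrB ?expn_gt0 ?prime_gt0 //.
  rewrite !natrX expT expM expS.
  move: (isotropic_number p r.+1 n.+1)%:R (isotropic_number p r.+1 n)%:R => u w.
  move: (2 * n)%N r.+1 => k m; rewrite !exprD.
  have := expf_neq0 k p0; have := expf_neq0 m p0; have := expf_neq0 (k * m) p0.
  move: (p%:R ^+ k) (p%:R ^+ m) (p%:R ^+ (k * m)) => a b c.
  move=> c0 b0 a0; field.
  by apply/and4P.
- by split=> [r _|n]; rewrite probE ?isotropic_number0 ?isotropic_number1
    ?prime_gt0 // ?muln1 ?muln0 ?expr0 ?divr1 // natrX divff ?expf_neq0.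
Qed.
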